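(* Assume that $d(s,a)>0$ for every $(s,a)\in\mathcal S\times\mathcal A$, that $\alpha\in(0,1)$, and that $Q_0\in\mathbb R^{|\mathcal S||\mathcal A|}$ is deterministic. Let $(Q_k)_{k\ge 0}$ be the i.i.d.-observation Q-learning iterates with natural filtration $(\mathcal F_k)_{k\ge0}$. Then for each $k\ge 0$ there exists an $\mathcal F_k$-measurable stochastic policy $\mu_k$ such that $$Q_{k+1}-Q^*=M_{\mu_k}(Q_k-Q^* )+\alpha w_k,$$ where, for any stochastic policy $\mu$, $M_\mu:=I-\alpha D+\alpha\gamma DP\Pi^\mu$, and $$w_k:=e_{(s_k,a_k)}\Big(r_{k+1}+\gamma\max_{u\in\mathcal A}Q_k(s'_k,u)-Q_k(s_k,a_k)\Big)-D(F(Q_k)-Q_k)$$ satisfies $\mathbb E[w_k\mid\mathcal F_k]=0$. Consequently, $$\mathbb E[Q_{k+1}-Q^*\mid\mathcal F_k]=M_{\mu_k}(Q_k-Q^* ).$$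
   Context: MDP. A finite discounted MDP has state space $\mathcal S=\{1,\dots,|\mathcal S|\}$, action space $\mathcal A=\{1,\dots,|\mathcal A|\}$, transition probabilities $P(s'\mid s,a)$, real one-step rewards $r(s,a,s')$, and discount factor $\gamma\in(0,1)$. Put $R(s,a):=\sum_{s'}P(s'\mid s,a)r(s,a,s')$. Q-functions are vectors $Q\in\mathbb R^{|\mathcal S||\mathcal A|}$ indexed by state-action pairs in a fixed order; $e_{(s,a)}$ is the standard basis vector of coordinate $(s,a)$. $P$ also denotes the $(|\mathcal S||\mathcal A|)\times|\mathcal S|$ matrix whose row $(s,a)$ is $P(\cdot\mid s,a)$, and $R$ the vector with entries $R(s,a)$. A stochastic policy is a map $\mu$ from $\mathcal S$ to probability distributions on $\mathcal A$; $\Pi^\mu$ is the $|\mathcal S|\times(|\mathcal S||\mathcal A|)$ matrix with $(\Pi^\mu Q)(s)=\sum_a\mu(a\mid s)Q(s,a)$. Put $V_Q(s):=\max_{a}Q(s,a)$ and $F(Q):=R+\gamma PV_Q$ (Bellman optimality operator); $Q^*$ is the unique fixed point of $F$. I.i.d.-observation Q-learning. At each time $k$, $(s_k,a_k)$ is sampled independently (of the past) with $\mathbb P(s_k=s,a_k=a)=d(s,a):=p(s)b(a\mid s)$, where $p$ is a distribution on $\mathcal S$ and $b$ a fixed behavior policy; then $s'_k\sim P(\cdot\mid s_k,a_k)$ and $r_{k+1}:=r(s_k,a_k,s'_k)$. With constant step-size $\alpha$, $$Q_{k+1}(s_k,a_k)=Q_k(s_k,a_k)+\alpha\big(r_{k+1}+\gamma\max_{u}Q_k(s'_k,u)-Q_k(s_k,a_k)\big),$$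 and all other coordinates are unchanged. $D:=\mathrm{diag}(d(s,a))$. The natural filtration is $\mathcal F_0:=\sigma(Q_0)$, $\mathcal F_k:=\sigma(Q_0,\{(s_t,a_t,s'_t,r_{t+1}):0\le t\le k-1\})$ for $k\ge1$. *)

(* Defs.v *)
From HB Require Import structures.
From mathcomp Require Import all_boot all_order all_algebra.
From mathcomp Require Import all_classical all_reals all_analysis.
Import Order.TTheory GRing.Theory Num.Theory.
Import numFieldNormedType.Exports.

Set Implicit Arguments.
Unset Strict Implicit.
Unset Printing Implicit Defensive.

Local Open Scope classical_set_scope.
Local Open Scope ring_scope.

Definition is_pmf (R : realType) (I : finType) (f : I -> R) : Prop :=
  (forall i, 0 <= f i) /\ \sum_i f i = 1.

(* The state and action spaces are 'I_nS.+1 and 'I_nA.+1, so that both are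
   nonempty. *)
Record mdp (R : realType) (nS nA : nat) := Mdp {
  trans : 'I_nS.+1 -> 'I_nA.+1 -> 'I_nS.+1 -> R;  (* trans s a s' = P(s'|s,a) *)
  reward : 'I_nS.+1 -> 'I_nA.+1 -> 'I_nS.+1 -> R;
  discount : R;
  trans_pmf : forall s a, is_pmf (trans s a);
  discount_gt0 : 0 < discount;
  discount_lt1 : discount < 1 }.

(* Vectors over state-action pairs are column vectors of height
   nS.+1 * nA.+1; the fixed order of the pairs is the one of mxvec_index. *)
Notation qvec R nS nA := 'cV[R]_(nS.+1 * nA.+1).

Definition qval (R : realType) (nS nA : nat) (Q : qvec R nS nA)
    (s : 'I_nS.+1) (a : 'I_nA.+1) : R :=
  Q (mxvec_index s a) 0.

Definition sa_row (R : realType) (nS nA : nat)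
    (f : 'I_nS.+1 -> 'I_nA.+1 -> R) : 'rV[R]_(nS.+1 * nA.+1) :=
  mxvec (\matrix_(s, a) f s a).

Lemma sa_rowE (R : realType) (nS nA : nat)
    (f : 'I_nS.+1 -> 'I_nA.+1 -> R) s a :
  sa_row f 0 (mxvec_index s a) = f s a.
Proof. by rewrite /sa_row mxvecE mxE. Qed.

Definition basis_vec (R : realType) (nS nA : nat)
    (s : 'I_nS.+1) (a : 'I_nA.+1) : qvec R nS nA :=
  delta_mx (mxvec_index s a) 0.

Definition trans_mx (R : realType) (nS nA : nat) (m : mdp R nS nA) :
    'M[R]_(nS.+1 * nA.+1, nS.+1) :=
  \matrix_(i, s') sa_row (fun s a => trans m s a s') 0 i.

Definition reward_vec (R : realType) (nS nA : nat) (m : mdp R nS nA) :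
    qvec R nS nA :=
  (sa_row (fun s a => \sum_s' trans m s a s' * reward m s a s'))^T.

(* The neutral element Q(s, ord0) is itself one of the values, so this is the
   maximum over all actions. *)
Definition max_act (R : realType) (nS nA : nat) (Q : qvec R nS nA)
    (s : 'I_nS.+1) : R :=
  \big[Num.max/qval Q s ord0]_(a < nA.+1) qval Q s a.

Definition value_vec (R : realType) (nS nA : nat) (Q : qvec R nS nA) :
    'cV[R]_nS.+1 :=
  \col_s max_act Q s.

Definition bellman (R : realType) (nS nA : nat) (m : mdp R nS nA)
    (Q : qvec R nS nA) : qvec R nS nA :=
  reward_vec m + discount m *: (trans_mx m *m value_vec Q).

Definition is_policy (R : realType) (nS nA : nat)
    (mu : 'I_nS.+1 -> 'I_nA.+1 -> R) : Prop :=
  forall s, is_pmf (mu s).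

Definition policy_mx (R : realType) (nS nA : nat)
    (mu : 'I_nS.+1 -> 'I_nA.+1 -> R) : 'M[R]_(nS.+1, nS.+1 * nA.+1) :=
  \matrix_(s, i) sa_row (fun s1 a => if s1 == s then mu s a else 0) 0 i.

Lemma policy_mxE (R : realType) (nS nA : nat)
    (mu : 'I_nS.+1 -> 'I_nA.+1 -> R) (Q : qvec R nS nA) s :
  (policy_mx mu *m Q) s 0 = \sum_a mu s a * qval Q s a.
Proof.
rewrite mxE (reindex _ (curry_mxvec_bij _ _)) /=.
transitivity (\sum_s1 \sum_a
  policy_mx mu s (mxvec_index s1 a) * Q (mxvec_index s1 a) 0).
  by rewrite pair_bigA /=; apply: eq_bigr => -[].
rewrite (bigD1 s) //= [X in _ + X]big1 ?addr0; last first.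
  move=> s1 /negbTE ns; rewrite big1// => a _.
  by rewrite mxE sa_rowE ns mul0r.
by apply: eq_bigr => a _; rewrite mxE sa_rowE eqxx.
Qed.

Definition sa_dist (R : realType) (nS nA : nat) (p : 'I_nS.+1 -> R)
    (b : 'I_nS.+1 -> 'I_nA.+1 -> R) (s : 'I_nS.+1) (a : 'I_nA.+1) : R :=
  p s * b s a.

Definition dist_mx (R : realType) (nS nA : nat)
    (dsa : 'I_nS.+1 -> 'I_nA.+1 -> R) : 'M[R]_(nS.+1 * nA.+1) :=
  diag_mx (sa_row dsa).

Definition switch_mx (R : realType) (nS nA : nat) (m : mdp R nS nA)
    (dsa : 'I_nS.+1 -> 'I_nA.+1 -> R) (alpha : R)
    (mu : 'I_nS.+1 -> 'I_nA.+1 -> R) : 'M[R]_(nS.+1 * nA.+1) :=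
  1%:M - alpha *: dist_mx dsa
  + (alpha * discount m) *: (dist_mx dsa *m trans_mx m *m policy_mx mu).

(* The observations s_k, a_k, s'_k as functions of the outcome. *)
Record samples (T : Type) (nS nA : nat) := Samples {
  st : nat -> T -> 'I_nS.+1;
  act : nat -> T -> 'I_nA.+1;
  nxt : nat -> T -> 'I_nS.+1 }.

(* rew m X k is r_{k+1}, the reward received at time k. *)
Definition rew (T : Type) (R : realType) (nS nA : nat) (m : mdp R nS nA)
    (X : samples T nS nA) (k : nat) (w : T) : R :=
  reward m (st X k w) (act X k w) (nxt X k w).

Definition td_error (T : Type) (R : realType) (nS nA : nat)
    (m : mdp R nS nA) (X : samples T nS nA) (k : nat) (Q : qvec R nS nA)
    (w : T) : R :=
  rew m X k w + discount m * max_act Q (nxt X k w)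
  - qval Q (st X k w) (act X k w).

Fixpoint qlearn (T : Type) (R : realType) (nS nA : nat) (m : mdp R nS nA)
    (alpha : R) (X : samples T nS nA) (Q0 : T -> qvec R nS nA) (k : nat)
    (w : T) : qvec R nS nA :=
  if k is k'.+1 then
    let Q := qlearn m alpha X Q0 k' w in
    \col_i (if i == mxvec_index (st X k' w) (act X k' w)
            then Q i 0 + alpha * td_error m X k' Q w
            else Q i 0)
  else Q0 w.

Definition noise (T : Type) (R : realType) (nS nA : nat) (m : mdp R nS nA)
    (dsa : 'I_nS.+1 -> 'I_nA.+1 -> R) (alpha : R) (X : samples T nS nA)
    (Q0 : T -> qvec R nS nA) (k : nat) (w : T) : qvec R nS nA :=
  let Q := qlearn m alpha X Q0 k w in
  td_error m X k Q w *: basis_vec R (st X k w) (act X k w)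
  - dist_mx dsa *m (bellman m Q - Q).

(* The natural filtration sigma(Q_0, (s_t, a_t, s'_t, r_{t+1}) : t < k); the
   finite spaces carry the discrete sigma-algebra, R the Borel one. *)
Definition nat_filtration (T : Type) (R : realType) (nS nA : nat)
    (m : mdp R nS nA) (X : samples T nS nA) (Q0 : T -> qvec R nS nA)
    (k : nat) : set (set T) :=
  <<s [set E : set T |
        (exists i, exists2 B : set R, measurable B &
           E = (fun w => Q0 w i 0) @^-1` B)
     \/ (exists2 t, (t < k)%N &
          [\/ exists B : set 'I_nS.+1, E = st X t @^-1` B,
              exists B : set 'I_nA.+1, E = act X t @^-1` B,
              exists B : set 'I_nS.+1, E = nxt X t @^-1` B
            | exists2 B : set R, measurable B & E = rew m X t @^-1` B])] >>.

(* The joint law of the observations: (s_k, a_k) has law dsa and is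
   independent of F_k; given F_k and (s_k, a_k), s'_k has law
   P(. | s_k, a_k). *)
Record iid_samples (d : measure_display) (T : measurableType d)
    (R : realType) (Pr : probability T R) (nS nA : nat) (m : mdp R nS nA)
    (dsa : 'I_nS.+1 -> 'I_nA.+1 -> R) (X : samples T nS nA)
    (Q0 : T -> qvec R nS nA) : Prop := IidSamples {
  st_meas : forall k s, measurable (st X k @^-1` [set s]);
  act_meas : forall k a, measurable (act X k @^-1` [set a]);
  nxt_meas : forall k s, measurable (nxt X k @^-1` [set s]);
  sa_law : forall k s a (E : set T), nat_filtration m X Q0 k E ->
    Pr (E `&` [set w | st X k w = s /\ act X k w = a])
    = (Pr E * (dsa s a)%:E)%E;
  nxt_law : forall k s a s' (E : set T), nat_filtration m X Q0 k E ->
    Pr (E `&` [set w | [/\ st X k w = s, act X k w = a & nxt X k w = s']])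
    = (Pr (E `&` [set w | st X k w = s /\ act X k w = a])
       * (trans m s a s')%:E)%E }.

Definition measurable_wrt (T : Type) (R : realType) (G : set (set T))
    (f : T -> R) : Prop :=
  forall B : set R, measurable B -> G (f @^-1` B).

(* Y is a version of the conditional expectation E[X | G]. *)
Definition is_cond_expect (d : measure_display) (T : measurableType d)
    (R : realType) (Pr : probability T R) (G : set (set T)) (X Y : T -> R) :
    Prop :=
  [/\ Pr.-integrable setT (EFin \o X),
      Pr.-integrable setT (EFin \o Y),
      measurable_wrt G Y
    & forall E, G E ->
        (\int[Pr]_(w in E) (Y w)%:E = \int[Pr]_(w in E) (X w)%:E)%E].

Definition is_cond_expect_vec (d : measure_display) (T : measurableType d)
    (R : realType) (Pr : probability T R) (G : set (set T)) (n : nat)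
    (X Y : T -> 'cV[R]_n) : Prop :=
  forall i, is_cond_expect Pr G (fun w => X w i 0) (fun w => Y w i 0).

(* Main.v *)
(* The Bellman difference F(Q_k) - Q* involves max_u Q_k - max_u Q*, which at
   each state lies between the values of Q_k - Q* at a greedy action of Q* and
   at a greedy action of Q_k; it is therefore the mean of Q_k - Q* under a
   policy mu_k that depends on Q_k only. As q0 is deterministic and the
   observations range over a finite set, Q_k is a function of an
   F_k-measurable variable with finitely many values. Every integral is then a
   finite sum, and E[w_k | F_k] = 0 reduces to the identity that the mean of
   the TD direction under d(s,a) P(s'|s,a) is D(F(Q) - Q). *)
Require Import Defs.
From HB Require Import structures.
From mathcomp Require Import all_boot all_order all_algebra.
From mathcomp Require Import all_classical all_reals all_analysis.
From mathcomp Require Import ring.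
Import Order.TTheory GRing.Theory Num.Theory.
Import numFieldNormedType.Exports.
Set Implicit Arguments.
Unset Strict Implicit.
Unset Printing Implicit Defensive.
Local Open Scope classical_set_scope.
Local Open Scope ring_scope.

(** * Differences of maxima as policy means *)

Lemma pmf_mean_between (R : realType) (I : finType) (x : I -> R) (i j : I)
    (y : R) : x i <= y <= x j ->
  exists f : I -> R, is_pmf f /\ \sum_k f k * x k = y.
Proof.
move=> /andP[xiy yxj].
(* If [x j = x i], division by zero gives [t = 0]. *)
pose t := (y - x i) / (x j - x i).
have [t0 t1] : 0 <= t /\ t <= 1.
  have [eq_ij|lt_ij] := eqVneq (x j) (x i).
    by rewrite /t eq_ij subrr invr0 mulr0.
  have ij_gt0 : 0 < x j - x i by rewrite subr_gt0 lt_def lt_ij (le_trans xiy).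
  rewrite /t ler_pdivrMr// mul1r lerD2r; split=> //.
  by rewrite divr_ge0 ?subr_ge0// -subr_ge0 ltW.
have tE : t * (x j - x i) = y - x i.
  have [eq_ij|lt_ij] := eqVneq (x j) (x i).
    rewrite eq_ij subrr mulr0; apply/esym/eqP; rewrite subr_eq0 eq_le xiy andbT.
    by rewrite -eq_ij.
  by rewrite divfK// subr_eq0.
(* Mass [t] at [j] and [1 - t] at [i]; adding the two indicators also covers [i = j]. *)
exists (fun k => t * (k == j)%:R + (1 - t) * (k == i)%:R); split.
  split=> [k|].
    by rewrite addr_ge0// mulr_ge0// subr_ge0.
  rewrite big_split/= -!mulr_sumr.
  have sum_pred1 (l : I) : \sum_k (k == l)%:R = 1 :> R.
    by rewrite (bigD1 l)//= eqxx big1 ?addr0// => k /negbTE ->.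
  by rewrite !sum_pred1 !mulr1 subrKC.
under eq_bigr do rewrite mulrDl.
have sum_pred1 c l : \sum_k (c * (k == l)%:R) * x k = c * x l.
  rewrite (bigD1 l)//= eqxx mulr1 big1 ?addr0// => k /negbTE ->.
  by rewrite mulr0 mul0r.
rewrite big_split/= !sum_pred1 mulrBl mul1r addrCA -mulrBr tE.
by rewrite subrKC.
Qed.

Lemma max_act_ge (R : realType) (nS nA : nat) (q : qvec R nS nA) s a :
  qval q s a <= max_act q s.
Proof. exact: (le_bigmax _ (qval q s)). Qed.

Lemma max_act_attained (R : realType) (nS nA : nat) (q : qvec R nS nA) s :
  exists a, max_act q s = qval q s a.
Proof.
rewrite /max_act; elim/big_ind: _ => [|x y [a ->] [b ->]|a _].
- by exists ord0.
- by rewrite /Num.max; case: ifP => _; [exists b|exists a].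
- by exists a.
Qed.

Lemma qvalB (R : realType) (nS nA : nat) (q q' : qvec R nS nA) s a :
  qval (q - q') s a = qval q s a - qval q' s a.
Proof. by rewrite /qval !mxE. Qed.

Lemma value_diff_policy (R : realType) (nS nA : nat) (q q' : qvec R nS nA) :
  exists mu : 'I_nS.+1 -> 'I_nA.+1 -> R, is_policy mu /\
    policy_mx mu *m (q - q') = value_vec q - value_vec q'.
Proof.
have /choice[mu mup] s : exists f : 'I_nA.+1 -> R, is_pmf f /\
    \sum_a f a * qval (q - q') s a = max_act q s - max_act q' s.
  have [a qa] := max_act_attained q s; have [b q'b] := max_act_attained q' s.
  (* With [a] greedy for [q] and [b] greedy for [q'], the lower bound uses [q b <= max q] and the
     upper bound [q' a <= max q']. *)
  apply: (@pmf_mean_between _ _ _ b a); rewrite !qvalB.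
  by rewrite q'b lerD2r max_act_ge /= qa -q'b lerB// max_act_ge.
exists mu; split=> [s|]; first by have [] := mup s.
apply/matrixP => s j; rewrite ord1 policy_mxE; have [_ ->] := mup s.
by rewrite !mxE.
Qed.

(** * One update step: switching form and mean direction *)

Definition td (R : realType) (nS nA : nat) (m : mdp R nS nA)
    (q : qvec R nS nA) (o : 'I_nS.+1 * 'I_nA.+1 * 'I_nS.+1) : R :=
  reward m o.1.1 o.1.2 o.2 + discount m * max_act q o.2 - qval q o.1.1 o.1.2.

(** The noise with the outcome abstracted away: [q] and the observed triple [o = (s, a, s')] vary
    separately, so averaging over [o] at fixed [q] is a finite sum. *)
Definition td_noise (R : realType) (nS nA : nat) (m : mdp R nS nA)
    (dsa : 'I_nS.+1 -> 'I_nA.+1 -> R) (q : qvec R nS nA)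
    (o : 'I_nS.+1 * 'I_nA.+1 * 'I_nS.+1) : qvec R nS nA :=
  td m q o *: basis_vec R o.1.1 o.1.2 - dist_mx dsa *m (bellman m q - q).

(** Since [q'] is a fixed point, rewards cancel in [F(q) - q' = F(q) - F(q')], leaving [gamma P (V_q
    - V_q') = gamma P Pi^mu (q - q')]. Hence [M_mu (q - q') = (q - q') + alpha D (F(q) - q)], and
    the drift cancels against the one subtracted in the noise. *)
Lemma switch_step (R : realType) (nS nA : nat) (m : mdp R nS nA)
    (dsa : 'I_nS.+1 -> 'I_nA.+1 -> R) (alpha : R) (q q' : qvec R nS nA) mu o :
  bellman m q' = q' ->
  policy_mx mu *m (q - q') = value_vec q - value_vec q' ->
  q + alpha *: (td m q o *: basis_vec R o.1.1 o.1.2) - q'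
  = switch_mx m dsa alpha mu *m (q - q') + alpha *: td_noise m dsa q o.
Proof.
move=> q'E muE; rewrite /switch_mx /td_noise.
rewrite 2!mulmxDl mul1mx mulNmx -!scalemxAl -!mulmxA muE scalerBr.
have -> : alpha * discount m *:
      (dist_mx dsa *m (trans_mx m *m (value_vec q - value_vec q')))
    = alpha *: (dist_mx dsa *m (bellman m q - q')).
  rewrite -[in RHS]q'E /bellman opprD addrACA subrr add0r -scalerBr -mulmxBr.
  by rewrite -scalemxAr scalerA.
have -> : bellman m q - q' = (bellman m q - q) + (q - q') by rewrite subrKA.
rewrite (mulmxDr (dist_mx dsa) (bellman m q - q)) scalerDr.
move: (dist_mx dsa *m _) (dist_mx dsa *m _) (td m q o *: _) => u v e.
by apply/matrixP => i j; rewrite !mxE; ring.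
Qed.

Lemma qval_bellman (R : realType) (nS nA : nat) (m : mdp R nS nA)
    (q : qvec R nS nA) s a :
  qval (bellman m q) s a
  = \sum_s' trans m s a s' * (reward m s a s' + discount m * max_act q s').
Proof.
rewrite /qval /bellman !mxE sa_rowE mulr_sumr -big_split/=.
apply: eq_bigr => s' _; rewrite !mxE sa_rowE mulrDr; congr (_ + _).
by rewrite mulrCA.
Qed.

Lemma basis_vecE (R : realType) (nS nA : nat) s a s' a' :
  basis_vec R s a (mxvec_index s' a') 0
  = ((s', a') == (s, a) :> 'I_nS.+1 * 'I_nA.+1)%:R.
Proof.
have <- : (delta_mx s a : 'M[R]_(nS.+1, nA.+1)) s' a' = ((s', a') == (s, a))%:R.
  by rewrite mxE.
by rewrite -[RHS]mxvecE mxvec_delta !mxE eqxx andbT.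
Qed.

(** The subtracted drift is constant in [o] and the weights sum to 1. In coordinate [(s, a)] the
    basis vector keeps only the triples starting with [(s, a)], whose TD errors average under
    [P(.|s,a)] to [F(q) - q] there. *)
Lemma mean_td_noise (R : realType) (nS nA : nat) (m : mdp R nS nA)
    (dsa : 'I_nS.+1 -> 'I_nA.+1 -> R) (q : qvec R nS nA) :
  \sum_s \sum_a dsa s a = 1 ->
  \sum_o (dsa o.1.1 o.1.2 * trans m o.1.1 o.1.2 o.2) *: td_noise m dsa q o = 0.
Proof.
move=> dsa1; under eq_bigr do rewrite scalerBr.
rewrite sumrB -scaler_suml.
rewrite -(pair_bigA _ (fun sa s' => dsa sa.1 sa.2 * trans m sa.1 sa.2 s'))/=.
have -> : \sum_(sa : 'I_nS.+1 * 'I_nA.+1) \sum_s'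
    dsa sa.1 sa.2 * trans m sa.1 sa.2 s' = 1.
  rewrite -dsa1 [RHS]pair_bigA; apply: eq_bigr => sa _.
  by have [_ tr1] := trans_pmf m sa.1 sa.2; rewrite -mulr_sumr tr1 mulr1.
rewrite scale1r; apply/eqP; rewrite subr_eq0; apply/eqP/matrixP => i j.
rewrite ord1 {j} summxE; case/mxvec_indexP: i => s a.
rewrite mul_diag_mx [RHS]mxE sa_rowE.
rewrite -(pair_bigA _ (fun sa s' => ((dsa sa.1 sa.2 * trans m sa.1 sa.2 s') *:
  (td m q (sa, s') *: basis_vec R sa.1 sa.2)) (mxvec_index s a) 0))/=.
rewrite (bigD1 (s, a))//= [X in _ + X]big1 ?addr0; last first.
  move=> [s1 a1] ne; rewrite big1// => s' _.
  by rewrite 2!mxE basis_vecE/= eq_sym (negbTE ne) !mulr0.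
have := qval_bellman m q s a; rewrite {1}/qval => bellmanE.
(* Writing [q(s,a)] as an average over [s'] lets both sides match term by term. *)
have qE : q (mxvec_index s a) 0 = \sum_s' trans m s a s' * qval q s a.
  by have [_ tr1] := trans_pmf m s a; rewrite -mulr_suml tr1 mul1r.
rewrite mxE bellmanE [(- q) _ _]mxE qE -sumrB mulr_sumr.
apply: eq_bigr => s' _; rewrite 2!mxE basis_vecE eqxx /td /qval/=; ring.
Qed.

(** * Measurability and integrals of finite-valued functions *)

Lemma measurable_fin_preimage (d : measure_display) (T : measurableType d)
    (I : finType) (f : T -> I) (B : set I) :
  (forall i, measurable (f @^-1` [set i])) -> measurable (f @^-1` B).
Proof.
move=> mf; have -> : f @^-1` B = \bigcup_(i in B) f @^-1` [set i].
  apply/seteqP; split=> [w fB|w [i iB /= ->]//].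
  by exists (f w).
by apply: fin_bigcup_measurable => // ; exact: finite_finset.
Qed.

Lemma measurable_pair_preimage (d : measure_display) (T : measurableType d)
    (I J : finType) (f : T -> I) (g : T -> J) :
  (forall i, measurable (f @^-1` [set i])) ->
  (forall j, measurable (g @^-1` [set j])) ->
  forall ij, measurable ((fun w => (f w, g w)) @^-1` [set ij]).
Proof.
move=> mf mg [i j].
rewrite (_ : _ @^-1` _ = f @^-1` [set i] `&` g @^-1` [set j]).
  exact: measurableI.
by apply/seteqP; split=> [w [<- <-]|w [<- <-]].
Qed.

Section finite_valued.
Context (d : measure_display) (T : measurableType d) (R : realType).
Context (mu : {finite_measure set T -> \bar R}) (I : finType) (f : T -> I).
Context (mf : forall i, measurable (f @^-1` [set i])).
Implicit Types (g : I -> R) (E : set T).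

(** Splitting along the level sets of [f] gives a finite combination of indicators, so integration
    reduces to linearity. *)
Let finite_valuedE g w :
  (g (f w))%:E = (\sum_i (g i)%:E * (\1_(f @^-1` [set i]) w)%:E)%E.
Proof.
rewrite (bigD1 (f w))//= big1 ?adde0; last first.
  move=> i ne; rewrite indicE memNset ?mule0//= => fwi.
  by rewrite fwi eqxx in ne.
by rewrite indicE mem_set// mule1.
Qed.

Let integrable_term g E i : measurable E ->
  mu.-integrable E (fun w => ((g i)%:E * (\1_(f @^-1` [set i]) w)%:E)%E).
Proof.
move=> mE; apply: integrableZl => //.
by apply: (@integrableS _ _ _ _ setT) => //; exact: integrable_indic.
Qed.

Lemma integrable_finite_valued g E : measurable E ->
  mu.-integrable E (EFin \o (g \o f)).
Proof.
move=> mE; rewrite (_ : EFin \o _ = fun w =>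
    \sum_i (g i)%:E * (\1_(f @^-1` [set i]) w)%:E)%E.
  by apply: integrable_sum => // i _; exact: integrable_term.
by apply/funext => w /=; rewrite finite_valuedE.
Qed.

Lemma integral_finite_valued g E : measurable E ->
  (\int[mu]_(w in E) (g (f w))%:E
   = \sum_i (g i)%:E * mu (E `&` f @^-1` [set i]))%E.
Proof.
move=> mE; under eq_integral do rewrite finite_valuedE.
rewrite integral_sum//; last by move=> i; exact: integrable_term.
apply: eq_bigr => i _; rewrite integralZl//.
  by rewrite integral_indic// setIC.
by apply: (@integrableS _ _ _ _ setT) => //; exact: integrable_indic.
Qed.

End finite_valued.

(** * The natural filtration, the law of an observation and the noise *)

Section filtration.
Context (d : measure_display) (T : measurableType d) (R : realType).
Context (Pr : probability T R) (nS nA : nat) (m : mdp R nS nA).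
Context (dsa : 'I_nS.+1 -> 'I_nA.+1 -> R) (X : samples T nS nA).
Context (q0 : qvec R nS nA).
Context (X_iid : iid_samples Pr m dsa X (fun=> q0)).
Local Notation F := (nat_filtration m X (fun=> q0)).

Definition obs k w := (st X k w, act X k w, nxt X k w).

Lemma nat_filtration_mono k : F k `<=` F k.+1.
Proof.
apply: sub_smallest2r; first exact: smallest_sigma_algebra.
by move=> E [?|[t tk ?]]; [left|right; exists t => //; exact: ltnW].
Qed.

(** [F k] is a generated sigma-algebra, so its members are the measurable sets of a
    [g_sigma_algebraType]. *)
Lemma nat_filtration_fin k (I : finType) (f : T -> I) (B : set I) :
  (forall i, F k (f @^-1` [set i])) -> F k (f @^-1` B).
Proof.
exact: (@measurable_fin_preimage _ (g_sigma_algebraType _)).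
Qed.

Lemma nat_filtration_pair k (I J : finType) (f : T -> I) (g : T -> J) :
  (forall i, F k (f @^-1` [set i])) -> (forall j, F k (g @^-1` [set j])) ->
  forall ij, F k ((fun w => (f w, g w)) @^-1` [set ij]).
Proof.
exact: (@measurable_pair_preimage _ (g_sigma_algebraType _)).
Qed.

(** The index shifts by one because [F k] is generated by the observations at times [t < k]. *)
Lemma nat_filtration_obs k o : F k.+1 (obs k @^-1` [set o]).
Proof.
apply: nat_filtration_pair => [|s']; first apply: nat_filtration_pair => [s|a].
- apply: sub_gen_smallest; right; exists k => //.
  by constructor 1; exists [set s].
- apply: sub_gen_smallest; right; exists k => //.
  by constructor 2; exists [set a].
- apply: sub_gen_smallest; right; exists k => //.
  by constructor 3; exists [set s'].
Qed.

Lemma measurable_obs k o : measurable (obs k @^-1` [set o]).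
Proof.
apply: measurable_pair_preimage; last exact: (nxt_meas X_iid).
apply: measurable_pair_preimage; first exact: (st_meas X_iid).
exact: (act_meas X_iid).
Qed.

Lemma nat_filtration_sub k : F k `<=` measurable.
Proof.
apply: smallest_sub; first exact: sigma_algebra_measurable.
move=> E [[i [B mB ->]]|[t tk [[B ->]|[B ->]|[B ->]|[B mB ->]]]].
(* The initial vector is constant, so its preimages are empty or everything. *)
- by rewrite preimage_cst; case: ifP.
- exact: measurable_fin_preimage (st_meas X_iid _).
- exact: measurable_fin_preimage (act_meas X_iid _).
- exact: measurable_fin_preimage (nxt_meas X_iid _).
- rewrite (_ : rew m X t @^-1` B =
    obs t @^-1` [set o | B (reward m o.1.1 o.1.2 o.2)])//.
  exact: measurable_fin_preimage (measurable_obs _).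
Qed.

(** Chaining the law of [(s_k, a_k)] with the transition kernel shows the whole triple to be
    independent of [F k]. *)
Lemma obs_law k o E : F k E ->
  Pr (E `&` obs k @^-1` [set o])
  = (Pr E * (dsa o.1.1 o.1.2 * trans m o.1.1 o.1.2 o.2)%:E)%E.
Proof.
case: o => -[s a] s' FE /=.
rewrite EFinM muleA -(sa_law X_iid (k := k))// -(nxt_law X_iid (k := k))//.
congr (Pr (_ `&` _)).
by apply/seteqP; split=> [w [<- <- <-]|w [<- <- <-]].
Qed.

Lemma qlearnS alpha k w (q := qlearn m alpha X (fun=> q0) k w) :
  qlearn m alpha X (fun=> q0) k.+1 w
  = q + alpha *: (td_error m X k q w *: basis_vec R (st X k w) (act X k w)).
Proof.
apply/matrixP => i j; rewrite ord1 !mxE -/q; case: eqP => _ /=.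
  by rewrite mulr1.
by rewrite !mulr0 addr0.
Qed.

(** By induction, [h] records the triples observed before time [k] and [g] replays the updates from
    them; the record starts in [unit] because [q0] is constant. *)
Lemma qlearn_factor alpha k :
  exists (I : finType) (h : T -> I) (g : I -> qvec R nS nA),
  (forall i, F k (h @^-1` [set i])) /\
  qlearn m alpha X (fun=> q0) k = g \o h.
Proof.
elim: k => [|k [I [h [g [Fh QE]]]]].
  exists unit, (fun=> tt), (fun=> q0); split=> // -[].
  rewrite preimage_cst mem_set//.
  exact: (@measurableT _ (g_sigma_algebraType _)).
pose J : finType := ('I_nS.+1 * 'I_nA.+1 * 'I_nS.+1)%type.
exists (I * J)%type, (fun w => (h w, obs k w)),
  (fun io => g io.1 + alpha *: (td m (g io.1) io.2 *:
               basis_vec R io.2.1.1 io.2.1.2)); split.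
  apply: nat_filtration_pair; last exact: nat_filtration_obs.
  by move=> i; exact: nat_filtration_mono.
by apply/funext => w; rewrite qlearnS QE.
Qed.


Lemma noiseE alpha k w :
  noise m dsa alpha X (fun=> q0) k w
  = td_noise m dsa (qlearn m alpha X (fun=> q0) k w) (obs k w).
Proof. by []. Qed.

Lemma noise_cond_expect0 alpha k : \sum_s \sum_a dsa s a = 1 ->
  is_cond_expect_vec Pr (F k) (noise m dsa alpha X (fun=> q0) k) (fun=> 0).
Proof.
move=> dsa1 i; have [I [h [g [Fh QE]]]] := qlearn_factor alpha k.
(* Past record and current triple together determine the noise. *)
pose z w := (h w, obs k w).
pose G (io : I * ('I_nS.+1 * 'I_nA.+1 * 'I_nS.+1)) :=
  td_noise m dsa (g io.1) io.2 i 0.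
have noiseGz : (fun w => noise m dsa alpha X (fun=> q0) k w i 0) = G \o z.
  by apply/funext => w; rewrite noiseE QE.
have mz : forall io, measurable (z @^-1` [set io]).
  apply: measurable_pair_preimage; last exact: measurable_obs.
  by move=> j; exact: nat_filtration_sub (Fh j).
rewrite noiseGz; split.
- exact: integrable_finite_valued.
- rewrite (_ : _ \o _ = cst 0%E); first exact: integrable0.
  by apply/funext => w /=; rewrite mxE.
- move=> B mB; rewrite preimage_cst; case: ifP => _.
    exact: (@measurableT _ (g_sigma_algebraType _)).
  exact: (@measurable0 _ (g_sigma_algebraType _)).
move=> E FE; rewrite (integral_finite_valued _ mz)//; last first.
  exact: nat_filtration_sub FE.
under eq_integral do rewrite mxE.
rewrite integral0; apply/esym.
transitivity (\sum_j \sum_o (G (j, o))%:E * Pr (E `&` z @^-1` [set (j, o)]))%E.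
  by rewrite pair_bigA; apply: eq_bigr => -[].
apply: big1 => j _.
(* On this event of [F k] the iterate is the constant [g j], while the current triple keeps its law;
   each [j] thus contributes a multiple of [mean_td_noise]. *)
have FEj : F k (E `&` h @^-1` [set j]).
  exact: (@measurableI _ (g_sigma_algebraType _) _ _ FE (Fh j)).
have lawz o : Pr (E `&` z @^-1` [set (j, o)])
    = (Pr (E `&` h @^-1` [set j])
       * (dsa o.1.1 o.1.2 * trans m o.1.1 o.1.2 o.2)%:E)%E.
  rewrite -(obs_law o FEj) -setIA; congr (Pr (_ `&` _)).
  by apply/seteqP; split=> [w [<- <-]|w [<- <-]].
have PrE : Pr (E `&` h @^-1` [set j]) = (fine (Pr (E `&` h @^-1` [set j])))%:E.
  by rewrite fineK// fin_num_measure//; exact: nat_filtration_sub FEj.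
under eq_bigr do rewrite lawz PrE -!EFinM.
rewrite sumEFin; congr EFin.
have := congr1 (fun v : qvec R nS nA => v i 0) (mean_td_noise m (g j) dsa1).
rewrite summxE mxE => mean0.
transitivity (fine (Pr (E `&` h @^-1` [set j])) * 0); last by rewrite mulr0.
rewrite -[in RHS]mean0 mulr_sumr.
by apply: eq_bigr => o _; rewrite [in RHS]mxE mulrC !mulrA.
Qed.
End filtration.

(** * The switched recursion and its conditional mean *)

Theorem theorem1 (disp : measure_display) (T : measurableType disp)
    (R : realType) (Pr : probability T R) (nS nA : nat) (m : mdp R nS nA)
    (p : 'I_nS.+1 -> R) (b : 'I_nS.+1 -> 'I_nA.+1 -> R)
    (alpha : R) (q0 Qstar : qvec R nS nA) (X : samples T nS nA)
    (p_pmf : is_pmf p) (b_policy : is_policy b)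
    (d_gt0 : forall s a, 0 < sa_dist p b s a)
    (alpha_gt0 : 0 < alpha) (alpha_lt1 : alpha < 1)
    (Qstar_fix : bellman m Qstar = Qstar)
    (X_iid : iid_samples Pr m (sa_dist p b) X (fun=> q0)) :
  let Q := qlearn m alpha X (fun=> q0) in
  let F := nat_filtration m X (fun=> q0) in
  let M := switch_mx m (sa_dist p b) alpha in
  let noise_k := noise m (sa_dist p b) alpha X (fun=> q0) in
  forall k : nat,
  exists mu : T -> 'I_nS.+1 -> 'I_nA.+1 -> R,
    [/\ (forall w, is_policy (mu w))
          /\ (forall s a, measurable_wrt (F k) (fun w => mu w s a)),
        forall w, Q k.+1 w - Qstar
          = M (mu w) *m (Q k w - Qstar) + alpha *: noise_k k w,
        is_cond_expect_vec Pr (F k) (noise_k k) (fun=> 0)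
      & is_cond_expect_vec Pr (F k) (fun w => Q k.+1 w - Qstar)
          (fun w => M (mu w) *m (Q k w - Qstar))].
Proof.
move=> Q F M noise_k k.
(* A policy is chosen once per vector [q] rather than per outcome, so that [mu_k] depends on the
   outcome only through [Q_k]. *)
have /choice[pol polP] : forall q : qvec R nS nA,
    exists mu : 'I_nS.+1 -> 'I_nA.+1 -> R, is_policy mu /\
    policy_mx mu *m (q - Qstar) = value_vec q - value_vec Qstar.
  by move=> q; exact: value_diff_policy.
have [I [h [g [Fh QE]]]] := qlearn_factor m X q0 alpha k.
have QkE w : Q k w = g (h w) by rewrite /Q QE.
have dsa1 : \sum_s \sum_a sa_dist p b s a = 1.
  have [_ <-] := p_pmf; apply: eq_bigr => s _.
  by have [_ b1] := b_policy s; rewrite -mulr_sumr b1 mulr1.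
have stepE w : Q k.+1 w - Qstar
    = M (pol (Q k w)) *m (Q k w - Qstar) + alpha *: noise_k k w.
  rewrite /Q qlearnS.
  exact: (switch_step _ _ (obs X k w) Qstar_fix (proj2 (polP _))).
have noise0 : is_cond_expect_vec Pr (F k) (noise_k k) (fun=> 0).
  exact: noise_cond_expect0.
exists (fun w => pol (Q k w)); split=> //.
  split=> [w|s a B mB]; first by have [] := polP (Q k w).
  (* The choice function [pol] is arbitrary; measurability comes from [h], which takes finitely many
     values. *)
  rewrite (_ : _ @^-1` B = h @^-1` [set j | B (pol (g j) s a)]).
    exact: nat_filtration_fin.
  by apply/seteqP; split=> w /=; rewrite QkE.
move=> i; have [int_noise _ _ noise_mean0] := noise0 i.
pose G j := (M (pol (g j)) *m (g j - Qstar)) i 0.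
have Y_E : (fun w => (M (pol (Q k w)) *m (Q k w - Qstar)) i 0) = G \o h.
  by apply/funext => w; rewrite /G /= QkE.
have mh j : measurable (h @^-1` [set j]).
  exact: (nat_filtration_sub X_iid (Fh j)).
have intY E : measurable E -> Pr.-integrable E (EFin \o (G \o h)).
  exact: integrable_finite_valued.
(* The error splits into a function of [h] plus [alpha] times the noise; only the first part
   survives integration over an event of [F k]. *)
have X_E : EFin \o (fun w => (Q k.+1 w - Qstar) i 0)
    = ((EFin \o (G \o h)) \+ (fun w => alpha%:E * (noise_k k w i 0)%:E))%E.
  apply/funext => w /=.
  by rewrite /G -QkE -EFinM -EFinD stepE 2!mxE [in LHS]mxE.
split.
- rewrite X_E; apply: integrableD => //; first exact: intY.
  exact: integrableZl.
- by rewrite Y_E; exact: intY.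
- move=> B mB; rewrite Y_E (_ : _ @^-1` B = h @^-1` [set j | B (G j)])//.
  exact: nat_filtration_fin.
move=> E FE; have mE : measurable E by exact: (nat_filtration_sub X_iid FE).
have int_noiseE : Pr.-integrable E (fun w => (noise_k k w i 0)%:E).
  exact: integrableS int_noise.
have -> : (\int[Pr]_(w in E) ((Q k.+1 w - Qstar) i 0)%:E
    = \int[Pr]_(w in E)
        ((EFin \o (G \o h)) w + alpha%:E * (noise_k k w i 0)%:E))%E.
  apply: eq_integral => w _.
  exact: (congr1 (fun f : T -> \bar R => f w) X_E).
rewrite integralD//; [|exact: intY|exact: integrableZl].
rewrite integralZl// -noise_mean0//.
under [X in (_ + _ * X)%E]eq_integral do rewrite mxE.
rewrite integral0 mule0 adde0.
by apply: eq_integral => w _; rewrite /= /G -QkE.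
Qed.
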